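(* Let $\mathbb{F}=\mathbb{R}$ or $\mathbb{F}=\mathbb{C}$. Let $T\in S^3(\mathbb{F}^2)$ be the symmetric tensor $$T=\left(\begin{array}{cc|cc}0&1&1&0\\1&0&0&2\end{array}\right),$$ i.e. $T(1,1,2)=T(1,2,1)=T(2,1,1)=1$, $T(2,2,2)=2$ and all other entries are $0$. Then $T$ has no optimal strongly orthogonal rank-$3$ approximation that is symmetric; that is, no minimizer of $\|T-Y\|$ over $Y\in\mathcal{SON}_3$ is a symmetric tensor.
   Context: The block notation lists the two $2\times2$ slices $T(\cdot,\cdot,1)$ and $T(\cdot,\cdot,2)$. Tensors in $\mathbb{F}^{n_1\times\cdots\times n_d}$ carry the inner product $\langle T,S\rangle=\sum_{i_1,\dots,i_d}T(i_1,\dots,i_d)\overline{S(i_1,\dots,i_d)}$ and norm $\|T\|=\sqrt{\langle T,T\rangle}$. The tensor $v_1\otimes\cdots\otimes v_d$ has entries $\prod_j v_j(i_j)$. $S^d(\mathbb{F}^n)$ denotes the tensors in $\mathbb{F}^{n\times\cdots\times n}$ ($d$ factors) invariant under all permutations of the $d$ indices (symmetric tensors). Two tensors $x=x_1\otimes\cdots\otimes x_d$ and $y=y_1\otimes\cdots\otimes y_d$ are strongly orthogonal if $\langle x,y\rangle=\prod_j\langle x_j,y_j\rangle=0$ and for each $j$ either $\langle x_j,y_j\rangle=0$ or $x_j=\mu_jy_j$ for some non-zero $\mu_j\in\mathbb{F}$. $\mathcal{SON}_r$ is the set of all tensors of the form $\sum_{k=1}^r\sigma_k\,v_{k1}\otimes\cdots\otimes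 v_{kd}$ with $\sigma_k\in\mathbb{F}$ (zero coefficients or zero vectors allowed, so that the rank is at most $r$) whose terms are pairwise strongly orthogonal. *)

(* Defs.v *)
From mathcomp Require Import all_boot all_order all_algebra all_fingroup.
From mathcomp Require Import reals complex.

Set Implicit Arguments.
Unset Strict Implicit.
Unset Printing Implicit Defensive.

Import Order.TTheory GRing.Theory Num.Theory.
Local Open Scope ring_scope.

(* An order-d tensor with all mode dimensions equal to n; a multi-index is a
   finite function i : {ffun 'I_d -> 'I_n}. *)
Definition tensor (F : numFieldType) (n d : nat) :=
  {ffun {ffun 'I_d -> 'I_n} -> F}.

Definition rank1 (F : numFieldType) (n d : nat) (v : 'I_d -> 'rV[F]_n) :
    tensor F n d :=
  [ffun i : {ffun 'I_d -> 'I_n} => \prod_(j < d) v j 0 (i j)].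

Definition symmetric_tensor (F : numFieldType) (n d : nat)
    (T : tensor F n d) : Prop :=
  forall (s : 'S_d) (i : {ffun 'I_d -> 'I_n}), T [ffun j => i (s j)] = T i.

(* The scalar field F over the reals R enters through its conjugation
   cj : F -> F and its real part re : F -> R, so that F = R (cj and re the
   identity) and F = R[i] are treated uniformly. *)
Section Scalars.
Variables (R : realType) (F : numFieldType) (cj : F -> F) (re : F -> R).

Definition vec_inner (n : nat) (x y : 'rV[F]_n) : F :=
  \sum_(i < n) x 0 i * cj (y 0 i).

Definition tensor_inner (n d : nat) (T S : tensor F n d) : F :=
  \sum_(i : {ffun 'I_d -> 'I_n}) T i * cj (S i).

(* The inner product of T with itself is real and nonnegative; re only moves
   it into R. *)
Definition tensor_norm (n d : nat) (T : tensor F n d) : R :=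
  Num.sqrt (re (tensor_inner T T)).

Definition strongly_orthogonal (n d : nat) (x y : 'I_d -> 'rV[F]_n) : Prop :=
  tensor_inner (rank1 x) (rank1 y) = 0 /\
  (forall j : 'I_d, vec_inner (x j) (y j) = 0 \/
     exists mu : F, mu != 0 /\ x j = mu *: y j).

Definition SON (n d r : nat) (Y : tensor F n d) : Prop :=
  exists (sigma : 'I_r -> F) (v : 'I_r -> 'I_d -> 'rV[F]_n),
    (forall k l : 'I_r, k != l -> strongly_orthogonal (v k) (v l)) /\
    Y = [ffun i => \sum_(k < r) sigma k * rank1 (v k) i].

Definition optimal_SON_approx (n d r : nat) (T Y : tensor F n d) : Prop :=
  SON r Y /\
  forall Z : tensor F n d, SON r Z -> tensor_norm (T - Y) <= tensor_norm (T - Z).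

End Scalars.

(* Indices are shifted to start from 0: the entries at (0,0,1), (0,1,0) and
   (1,0,0) are 1 and the entry at (1,1,1) is 2. *)
Definition example_tensor (F : numFieldType) : tensor F 2 3 :=
  [ffun i : {ffun 'I_3 -> 'I_2} =>
    match nat_of_ord (i 0), nat_of_ord (i 1), nat_of_ord (i 2) return F with
    | 0%N, 0%N, 1%N | 0%N, 1%N, 0%N | 1%N, 0%N, 0%N => 1
    | 1%N, 1%N, 1%N => 2
    | _, _, _ => 0
    end].

(* Main.v *)
Require Import Defs.
From mathcomp Require Import all_boot all_order all_algebra all_fingroup.
From mathcomp Require Import reals complex ring.

(* Three rank-one terms in C^2 (x) C^2 (x) C^2 that are pairwise strongly
   orthogonal are supported on three vertices of the cube {0,1}^3 in some
   product of orthogonal bases (a_j, perp a_j).  If their sum Y is symmetric,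
   contracting it in one mode yields symmetric matrices, which force the bases
   of the three modes to agree: with b = perp a, Y is either a combination of
   the cubes of a and b or a multiple of aab + aba + baa.  Since T has squared
   norm 7 and its component along either kind of support has squared norm at
   most 25/4 (Parseval in the basis (a, b)), the squared distance from T to Y
   is at least 3/4.  A nonsymmetric approximation does better: in the basis
   u = (1,1), v = (1,-1), keeping the uuu, vvv and uuv components of T leaves
   squared distance 5/8. *)

Set Implicit Arguments.
Unset Strict Implicit.
Unset Printing Implicit Defensive.

Import Order.TTheory GRing.Theory Num.Theory.
Local Open Scope ring_scope.

Lemma ord2P (i : 'I_2) : i = 0 \/ i = 1.
Proof. by case: i => [[|[|m]] hm] //; [left|right]; apply/val_inj. Qed.

(** Certificate checker: two symmetry equations are combined with cofactors [p], [q] given by the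
    caller, and [ring] verifies the combination. *)
Lemma lincomb_eq0 (K : comNzRingType) (p q u v u' v' t : K) :
  u = v -> u' = v' -> t = p * (u - v) + q * (u' - v') -> t = 0.
Proof. by move=> -> -> ->; rewrite !subrr !mulr0 addr0. Qed.

(** * Plane vectors over a field with conjugation *)

Section Scalars.
(** Both the identity on the reals and complex conjugation obey these laws, so the two cases share
    one proof. *)
Variables (F : numFieldType) (cj : {rmorphism F -> F}).
Hypothesis cjK : involutive cj.
Hypothesis mul_cj : forall x, x * cj x = `|x| ^+ 2.

Implicit Types (a b c x z : 'rV[F]_2) (y : 'I_2 -> 'I_2 -> 'I_2 -> F).

Definition det2 a b : F := a 0 0 * b 0 1 - a 0 1 * b 0 0.

Definition sqn a : F := `|a 0 0| ^+ 2 + `|a 0 1| ^+ 2.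

(* Conjugating the entries makes [perp a] Hermitian-orthogonal to [a]. *)
Definition perp a : 'rV[F]_2 :=
  \row_i (if i == 0 then - cj (a 0 1) else cj (a 0 0)).

Lemma perp0 a : perp a 0 0 = - cj (a 0 1). Proof. by rewrite mxE. Qed.

Lemma perp1 a : perp a 0 1 = cj (a 0 0). Proof. by rewrite mxE. Qed.

Lemma row2P a b : a 0 0 = b 0 0 -> a 0 1 = b 0 1 -> a = b.
Proof. by move=> h0 h1; apply/rowP => i; case: (ord2P i) => ->. Qed.

Lemma scE (k : F) a (i : 'I_2) : (k *: a) 0 i = k * a 0 i.
Proof. exact: mxE. Qed.

Lemma scDE (k l : F) a b (i : 'I_2) :
  (k *: a + l *: b) 0 i = k * a 0 i + l * b 0 i.
Proof. by rewrite mxE !scE. Qed.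

Lemma perpK a : perp (perp a) = - a.
Proof.
by apply: row2P; rewrite ?perp0 ?perp1 !mxE ?perp0 ?perp1 ?rmorphN cjK.
Qed.

Lemma perpZ (k : F) a : perp (k *: a) = cj k *: perp a.
Proof.
by apply: row2P; rewrite !mxE /= rmorphM ?mulrN.
Qed.

Lemma sqnE a : sqn a = a 0 0 * cj (a 0 0) + a 0 1 * cj (a 0 1).
Proof. by rewrite /sqn !mul_cj. Qed.

Lemma sqn_gt0 a : a != 0 -> 0 < sqn a.
Proof.
move=> a0; rewrite lt_neqAle addr_ge0 ?sqr_ge0 ?exprn_ge0 // andbT eq_sym.
apply: contra a0; rewrite /sqn paddr_eq0 ?exprn_ge0 // !expf_eq0 /= !normr_eq0.
by move=> /andP[/eqP h0 /eqP h1]; apply/eqP/row2P; rewrite mxE.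
Qed.

Lemma perp_neq0 a : a != 0 -> perp a != 0.
Proof.
move=> a0; apply: contra a0 => /eqP h; have := perpK a.
rewrite h => e; rewrite -[a]opprK -e oppr_eq0; apply/eqP/row2P;
by rewrite !mxE /= rmorph0 ?oppr0.
Qed.

Lemma det2_perp a b : det2 (perp a) (perp b) = cj (det2 a b).
Proof. by rewrite /det2 !perp0 !perp1 rmorphB !rmorphM; ring. Qed.

Lemma det2_eq0 a b : b != 0 -> det2 a b = 0 -> exists k, a = k *: b.
Proof.
move=> b0 h.
have [e|e] := eqVneq (b 0 0) 0; last first.
  exists (a 0 0 / b 0 0); apply: row2P; rewrite mxE ?divfK //.
  apply: (mulIf e); rewrite mulrAC divfK //.
  by apply/eqP; rewrite eq_sym -subr_eq0; apply/eqP.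
have e1 : b 0 1 != 0.
  by apply: contra b0 => /eqP e1; apply/eqP/row2P; rewrite mxE.
exists (a 0 1 / b 0 1); apply: row2P; rewrite mxE ?divfK //.
move: h; rewrite /det2 e !mulr0 subr0 => /eqP.
by rewrite mulf_eq0 (negPf e1) orbF => /eqP ->.
Qed.

(** The inner product of [a] with [b] equals [det2 a (perp b)]. *)
Lemma orth_perp a b : b != 0 -> vec_inner cj a b = 0 ->
  exists k, a = k *: perp b.
Proof.
move=> b0 h; apply: det2_eq0; first exact: perp_neq0.
move: h; rewrite /vec_inner !big_ord_recl big_ord0 /det2 perp0 perp1 => <-.
by rewrite (_ : lift ord0 ord0 = 1); [ring | apply/val_inj].
Qed.

(** * Symmetric tensors in product bases *)

Definition sym3 y := (forall i j k, y i j k = y j i k) /\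
              (forall i j k, y i j k = y i k j).

(** The bracket after [l1] is the W tensor of the basis [a], [perp a]. *)
Definition canonical y := exists a l0 l1 l3,
  [/\ a != 0, forall i j k, y i j k =
    l0 * (a 0 i * a 0 j * a 0 k)
    + l1 * (perp a 0 i * a 0 j * a 0 k + a 0 i * perp a 0 j * a 0 k
            + a 0 i * a 0 j * perp a 0 k)
    + l3 * (perp a 0 i * perp a 0 j * perp a 0 k)
  & l1 = 0 \/ l0 = 0 /\ l3 = 0].

(** Contracting the first mode with [a], then with [perp a], leaves symmetric matrices of rank at
    most one, so [x] is parallel to [b] and [z] to [perp b]. Contracting the last mode likewise
    makes [a] parallel to [b] unless both terms vanish. *)
Lemma canonical12 y a b x z : sym3 y -> a != 0 -> b != 0 ->
  (forall i j k, y i j k =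
     a 0 i * b 0 j * x 0 k + perp a 0 i * perp b 0 j * z 0 k) ->
  canonical y.
Proof.
move=> [s12 s23] a0 b0 h.
have Na := lt0r_neq0 (sqn_gt0 a0); have Nb := lt0r_neq0 (sqn_gt0 b0).
have [xi ex] : exists k, x = k *: b.
  apply: det2_eq0 => //; apply/eqP; rewrite -(mulrI_eq0 _ (mulfI Na)).
  have h0 := s23 0 0 1; have h1 := s23 1 0 1; rewrite !h !perp0 !perp1 in h0 h1.
  rewrite sqnE /det2.
  apply/eqP.
  apply: (lincomb_eq0 (p := - cj (a 0 0)) (q := - cj (a 0 1)) h0 h1); ring.
have [ze ez] : exists k, z = k *: perp b.
  apply: det2_eq0; first exact: perp_neq0.
  apply/eqP; rewrite -(mulrI_eq0 _ (mulfI Na)).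
  have h0 := s23 0 0 1; have h1 := s23 1 0 1; rewrite !h !perp0 !perp1 in h0 h1.
  rewrite sqnE /det2 !perp0 !perp1.
  apply/eqP.
  apply: (lincomb_eq0 (p := a 0 1) (q := - a 0 0) h0 h1); ring.
have hx : xi * det2 a b = 0.
  apply/eqP; rewrite -(mulrI_eq0 _ (mulfI Nb)).
  have h0 := s12 0 1 0; have h1 := s12 0 1 1.
  rewrite !h ex ez !mxE /= in h0 h1.
  rewrite sqnE /det2.
  apply/eqP.
  apply: (lincomb_eq0 (p := cj (b 0 0)) (q := cj (b 0 1)) h0 h1); ring.
have hz : ze * cj (det2 a b) = 0.
  rewrite -det2_perp.
  apply/eqP; rewrite -(mulrI_eq0 _ (mulfI Nb)).
  have h0 := s12 0 1 0; have h1 := s12 0 1 1.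
  rewrite !h ex ez !mxE /= in h0 h1.
  rewrite sqnE /det2 !perp0 !perp1.
  apply/eqP.
  apply: (lincomb_eq0 (p := - b 0 1) (q := b 0 0) h0 h1); ring.
have [e|e] := eqVneq (det2 a b) 0.
  have [k ek] := det2_eq0 b0 e.
  exists b, (xi * k), 0, (ze * cj k); split => //; last by left.
  move=> i j l; by rewrite h ex ez ek perpZ !scE; ring.
have x0 : xi = 0 by apply: (mulIf e); rewrite hx mul0r.
have z0 : ze = 0.
  have e' : cj (det2 a b) != 0 by rewrite fmorph_eq0.
  by apply: (mulIf e'); rewrite hz mul0r.
exists b, 0, 0, 0; split => //; last by left.
move=> i j l; by rewrite h ex ez x0 z0 !scE; ring.
Qed.

Lemma canonical13 y a b x z : sym3 y -> a != 0 -> b != 0 ->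
  (forall i j k, y i j k =
     a 0 i * x 0 j * b 0 k + perp a 0 i * z 0 j * perp b 0 k) ->
  canonical y.
Proof.
move=> sy a0 b0 h; apply: (canonical12 (x := x) (z := z) sy a0 b0).
by move=> i j k; rewrite sy.2 h; ring.
Qed.

Lemma canonical23 y a b x z : sym3 y -> a != 0 -> b != 0 ->
  (forall i j k, y i j k =
     x 0 i * a 0 j * b 0 k + z 0 i * perp a 0 j * perp b 0 k) ->
  canonical y.
Proof.
move=> sy a0 b0 h; apply: (canonical13 (x := x) (z := z) sy a0 b0).
by move=> i j k; rewrite sy.1 h; ring.
Qed.

(** Symmetry equates [al], [be] and [ga]; the vanishing product then kills either all of them or
    [de]. *)
Lemma canonicalW_parallel y a (al be ga de : F) : sym3 y -> a != 0 ->
  (forall i j k, y i j k = al * (perp a 0 i * a 0 j * a 0 k)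
    + be * (a 0 i * perp a 0 j * a 0 k) + ga * (a 0 i * a 0 j * perp a 0 k)
    + de * (a 0 i * a 0 j * a 0 k)) ->
  al * be * ga * de = 0 -> canonical y.
Proof.
move=> [s12 s23] a0 h p0.
have Na := lt0r_neq0 (sqn_gt0 a0).
have hbg : be = ga.
  apply: (mulIf (expf_neq0 2 Na)).
  have h0 := s23 0 0 1; have h1 := s23 1 0 1; rewrite !h !perp0 !perp1 in h0 h1.
  rewrite sqnE.
  apply: subr0_eq.
  apply: (lincomb_eq0 (p := - cj (a 0 0)) (q := - cj (a 0 1)) h0 h1); ring.
have hab : al = be.
  apply: (mulIf (expf_neq0 2 Na)).
  have h0 := s12 0 1 0; have h1 := s12 0 1 1; rewrite !h !perp0 !perp1 in h0 h1.
  rewrite sqnE.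
  apply: subr0_eq.
  apply: (lincomb_eq0 (p := - cj (a 0 0)) (q := - cj (a 0 1)) h0 h1); ring.
subst al be; exists a, de, ga, 0; split => //.
  by move=> i j k; rewrite h; ring.
by move/eqP: p0; rewrite !mulf_eq0 !orbb => /orP[/eqP|/eqP]; [left|right].
Qed.

(** Contracting one mode with its [perp] vector isolates one term, and symmetry in the other two
    modes gives [ha], [hb], [hc]. Unless [a], [b], [c] are all parallel, two of [al], [be], [ga]
    vanish and [y] is a simple tensor. *)
Lemma canonicalW y a b c (al be ga de : F) : sym3 y ->
  a != 0 -> b != 0 -> c != 0 ->
  (forall i j k, y i j k = al * (perp a 0 i * b 0 j * c 0 k)
    + be * (a 0 i * perp b 0 j * c 0 k) + ga * (a 0 i * b 0 j * perp c 0 k)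
    + de * (a 0 i * b 0 j * c 0 k)) ->
  al * be * ga * de = 0 -> canonical y.
Proof.
move=> sy a0 b0 c0 h p0; have [s12 s23] := sy.
have Na := lt0r_neq0 (sqn_gt0 a0); have Nb := lt0r_neq0 (sqn_gt0 b0).
have Nc := lt0r_neq0 (sqn_gt0 c0).
have ha : al * det2 b c = 0.
  apply/eqP; rewrite -(mulrI_eq0 _ (mulfI Na)).
  have h0 := s23 0 0 1; have h1 := s23 1 0 1; rewrite !h !perp0 !perp1 in h0 h1.
  rewrite sqnE /det2.
  apply/eqP.
  apply: (lincomb_eq0 (p := - a 0 1) (q := a 0 0) h0 h1); ring.
have hb : be * det2 a c = 0.
  apply/eqP; rewrite -(mulrI_eq0 _ (mulfI Nb)).
  have h0 : y 0 0 1 = y 1 0 0 by rewrite s23 s12.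
  have h1 : y 0 1 1 = y 1 1 0 by rewrite s12 s23.
  rewrite !h !perp0 !perp1 in h0 h1.
  rewrite sqnE /det2.
  apply/eqP.
  apply: (lincomb_eq0 (p := - b 0 1) (q := b 0 0) h0 h1); ring.
have hc : ga * det2 a b = 0.
  apply/eqP; rewrite -(mulrI_eq0 _ (mulfI Nc)).
  have h0 := s12 0 1 0; have h1 := s12 0 1 1; rewrite !h !perp0 !perp1 in h0 h1.
  rewrite sqnE /det2.
  apply/eqP.
  apply: (lincomb_eq0 (p := - c 0 1) (q := c 0 0) h0 h1); ring.
have par (k l : F) : a = k *: c -> b = l *: c -> canonical y.
  move=> ea eb.
  apply: (canonicalW_parallel (a := c) (al := al * cj k * l)
    (be := be * k * cj l) (ga := ga * k * l) (de := de * k * l)) => //.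
    by move=> i j m; rewrite h ea eb !perpZ !scE; ring.
  rewrite (_ : _ * _ = al * be * ga * de * (k ^+ 3 * l ^+ 3 * cj k * cj l)).
    by rewrite p0 mul0r.
  by ring.
have nil (u v : F) : u * v = 0 -> v != 0 -> u = 0.
  by move=> /eqP + v0; rewrite mulf_eq0 (negPf v0) orbF => /eqP.
have [e1|e1] := eqVneq (det2 b c) 0; last first.
  have al0 := nil _ _ ha e1.
  have [e2|e2] := eqVneq (det2 a c) 0; last first.
    have be0 := nil _ _ hb e2.
    apply: (canonical12 (x := ga *: perp c + de *: c) (z := 0) sy a0 b0).
    move=> i j k; rewrite h al0 be0 [(0 : 'rV_2) 0 k]mxE scDE.
    by ring.
  have [k ek] := det2_eq0 c0 e2.
  have ga0 : ga = 0.
    apply: nil hc _; apply: contra e1 => /eqP e3.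
    have k0 : k != 0.
      by apply: contra a0 => /eqP k0; rewrite ek k0 scale0r.
    rewrite -(mulrI_eq0 _ (mulfI k0)) -oppr_eq0 -e3 ek /det2 !mxE.
    by apply/eqP; ring.
  apply: (canonical13 (x := be *: perp b + de *: b) (z := 0) sy a0 c0).
  move=> i j l; rewrite h al0 ga0 [(0 : 'rV_2) 0 j]mxE scDE.
  by ring.
have [l el] := det2_eq0 c0 e1.
have [e2|e2] := eqVneq (det2 a c) 0.
  by have [k ek] := det2_eq0 c0 e2; exact: par ek el.
have be0 := nil _ _ hb e2.
have ga0 : ga = 0.
  apply: nil hc _; apply: contra e2 => /eqP e3.
  have l0 : l != 0.
    by apply: contra b0 => /eqP l0; rewrite el l0 scale0r.
  rewrite -(mulrI_eq0 _ (mulfI l0)) -e3 el /det2 !mxE.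
  by apply/eqP; ring.
apply: (canonical23 (x := al *: perp a + de *: a) (z := 0) sy b0 c0).
move=> i j k; rewrite h be0 ga0 [(0 : 'rV_2) 0 i]mxE scDE.
ring.
Qed.

(** * Bit patterns of three terms on the cube *)

Definition bvec (s : bool) a := if s then perp a else a.

Lemma bvec_neq0 s a : a != 0 -> bvec s a != 0.
Proof. by case: s => //; exact: perp_neq0. Qed.

(** Equal bits in two modes sort the terms into those along [a], [b] and those along [perp a],
    [perp b]; the boolean factors do the sorting. *)
Lemma canonical_equal_bits y a b c (c0 c1 c2 : F) s t s3 t3 :
  sym3 y -> a != 0 -> b != 0 ->
  (forall i j k, y i j k = c0 * (a 0 i * b 0 j * c 0 k)
    + c1 * (bvec s a 0 i * bvec s b 0 j * bvec s3 c 0 k)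
    + c2 * (bvec t a 0 i * bvec t b 0 j * bvec t3 c 0 k)) ->
  canonical y.
Proof.
move=> sy a0 b0 h.
apply: (canonical12 (x := c0 *: c + ((~~ s)%:R * c1 *: bvec s3 c
                                    + (~~ t)%:R * c2 *: bvec t3 c))
  (z := s%:R * c1 *: bvec s3 c + t%:R * c2 *: bvec t3 c) sy a0 b0).
move=> i j k; rewrite h scDE [(_ *: c + _) 0 k]mxE scDE scE.
by case: s t {h} => -[] /=; ring.
Qed.

Lemma canonical_three_terms y a b c (c0 c1 c2 : F) s1 s2 s3 t1 t2 t3 :
  sym3 y -> a != 0 -> b != 0 -> c != 0 ->
  (forall i j k, y i j k = c0 * (a 0 i * b 0 j * c 0 k)
    + c1 * (bvec s1 a 0 i * bvec s2 b 0 j * bvec s3 c 0 k)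
    + c2 * (bvec t1 a 0 i * bvec t2 b 0 j * bvec t3 c 0 k)) ->
  canonical y.
Proof.
move=> sy a0 b0 n0 h.
have [/eqP[]|d12] := boolP ((s1, t1) == (s2, t2)).
  by move=> e1 e2; subst s2 t2; exact: (canonical_equal_bits sy a0 b0 h).
have [/eqP[]|d13] := boolP ((s1, t1) == (s3, t3)).
  move=> e1 e2; subst s3 t3.
  apply: (@canonical_equal_bits y a c b c0 c1 c2 s1 t1 s2 t2 sy a0 n0).
  by move=> i j k; rewrite sy.2 h; ring.
have [/eqP[]|d23] := boolP ((s2, t2) == (s3, t3)).
  move=> e1 e2; subst s3 t3.
  apply: (@canonical_equal_bits y b c a c0 c1 c2 s2 t2 s1 t1 sy b0 n0).
  by move=> i j k; rewrite sy.2 sy.1 h; ring.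
(* The bit pairs of the three modes are now distinct, so exactly one of the four pairs is missing.
   [co] is the coefficient of the only term along the second vector of a mode; the sign of [- c0]
   comes from [perpK]. *)
pose co (s t : bool) :=
  if s then if t then - c0 else c1 else if t then c2 else 0.
pose miss (s t : bool) := (s, t) \notin [:: (s1, t1); (s2, t2); (s3, t3)].
(* Flip the basis in the mode, if any, where both bits are set: each mode then
   has at most one term along its second basis vector. *)
apply: (@canonicalW y (bvec (s1 && t1) a) (bvec (s2 && t2) b)
  (bvec (s3 && t3) c) (co s1 t1) (co s2 t2) (co s3 t3)
  ((miss true true)%:R * c0 + (miss true false)%:R * c1
   + (miss false true)%:R * c2)) => //; try exact: bvec_neq0.
- move=> i j k; rewrite h.
  have perpKE (x : 'rV[F]_2) (l : 'I_2) : perp (perp x) 0 l = - x 0 l.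
    by rewrite perpK mxE.
  rewrite /co /miss.
  by move: s1 s2 s3 t1 t2 t3 d12 d13 d23 {h co miss};
    do 6 case; move=> //= _ _ _; rewrite ?perpKE; ring.
(* If [(false, false)] occurs, its [co] is 0; otherwise no other pair is missing and the last
   coefficient is 0. *)
- by rewrite /co /miss; move: s1 s2 s3 t1 t2 t3 d12 d13 d23 {h co miss};
    do 6 case; move=> //= _ _ _; ring.
Qed.

(** * From strong orthogonality to coordinates *)

(** In a plane, the vectors orthogonal to a nonzero [w k0] form the line of [perp (w k0)], so any
    nonzero member of the family fixes the basis. *)
Lemma mode_basis (w : 'I_3 -> 'rV[F]_2) :
  (forall k l, k != l -> vec_inner cj (w k) (w l) = 0 \/
     exists mu, mu != 0 /\ w k = mu *: w l) ->
  exists a (co : 'I_3 -> F) (s : 'I_3 -> bool),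
    [/\ a != 0, s 0 = false & forall k, w k = co k *: bvec (s k) a].
Proof.
move=> h.
have main k0 : w k0 != 0 -> exists (co : 'I_3 -> F) (s : 'I_3 -> bool),
    s k0 = false /\ forall k, w k = co k *: bvec (s k) (w k0).
  move=> w0.
  have /fin_all_exists[f fP] : forall k, exists cs : F * bool,
      w k = cs.1 *: bvec cs.2 (w k0) /\ (k == k0 -> cs.2 = false).
    move=> k; have [->|kk0] := eqVneq k k0.
      by exists (1, false); rewrite scale1r.
    have [/(orth_perp w0)[c e]|[mu [_ e]]] := h _ _ kk0.
      by exists (c, true).
    by exists (mu, false).
  exists (fun k => (f k).1), (fun k => (f k).2); split.
    exact: (fP k0).2.
  by move=> k; case: (fP k).
have [e|w0] := eqVneq (w 0) 0; last first.
  by have [co [s [s0 hs]]] := main 0 w0; exists (w 0), co, s.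
have [k0 /= w0|none] := pickP (fun k => w k != 0).
  have [co [s [s0 hs]]] := main k0 w0.
  (* Since [w 0] is zero, its coefficient is set to 0 and its bit to [false]. *)
  exists (w k0), (fun k => if k == 0 then 0 else co k),
    (fun k => if k == 0 then false else s k); split => // k.
  by have [->|_] := eqVneq k 0; rewrite ?e ?scale0r.
(* All the vectors vanish, so any nonzero [a] serves. *)
exists (const_mx 1), (fun=> 0), (fun=> false); split => //.
  by apply/eqP => /rowP/(_ 0); rewrite !mxE => /eqP; rewrite oner_eq0.
by move=> k; rewrite scale0r; apply/eqP; have := none k; case: eqP.
Qed.

Definition idx3 (i j k : 'I_2) : {ffun 'I_3 -> 'I_2} :=
  [ffun m => tnth [tuple i; j; k] m].

Lemma ord3P (m : 'I_3) : [\/ m = 0, m = 1 | m = 2].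
Proof.
by case: m => [[|[|[|m]]] hm] //;
  [constructor 1|constructor 2|constructor 3]; apply/val_inj.
Qed.

Lemma big_ord2 (G : 'I_2 -> F) : \sum_i G i = G 0 + G 1.
Proof.
rewrite !big_ord_recl big_ord0 addr0.
by congr (_ + G _); apply/val_inj.
Qed.

Lemma big_ord3 (G : 'I_3 -> F) : \sum_i G i = G 0 + G 1 + G 2.
Proof.
rewrite !big_ord_recl big_ord0 addr0 addrA.
by congr (_ + G _ + G _); apply/val_inj.
Qed.

Lemma prod_ord3 (G : 'I_3 -> F) : \prod_i G i = G 0 * G 1 * G 2.
Proof.
rewrite !big_ord_recl big_ord0 mulr1 mulrA.
by congr (_ * G _ * G _); apply/val_inj.
Qed.

Lemma sum_idx3 (G : {ffun 'I_3 -> 'I_2} -> F) :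
  \sum_f G f = \sum_i \sum_j \sum_k G (idx3 i j k).
Proof.
under [RHS]eq_bigr do rewrite pair_big.
rewrite pair_big /=.
rewrite (reindex (fun x : 'I_2 * ('I_2 * 'I_2) => idx3 x.1 x.2.1 x.2.2)) //=.
apply: onW_bij; exists (fun f : {ffun 'I_3 -> 'I_2} => (f 0, (f 1, f 2))).
  by move=> [i [j k]]; rewrite /= !ffunE.
move=> f; apply/ffunP => m; rewrite ffunE.
by case: (ord3P m) => ->.
Qed.

Definition entry (Y : tensor F 2 3) i j k := Y (idx3 i j k).

Lemma symmetric_entry Y : symmetric_tensor Y -> sym3 (entry Y).
Proof.
move=> sY; split=> i j k; rewrite /entry.
  rewrite -(sY (tperm 0 1) (idx3 i j k)); congr (Y _); apply/ffunP => m.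
  by rewrite !ffunE permE /=; case: (ord3P m) => ->.
rewrite -(sY (tperm 1 2) (idx3 i j k)); congr (Y _); apply/ffunP => m.
by rewrite !ffunE permE /=; case: (ord3P m) => ->.
Qed.

Lemma rank1_idx3 (v : 'I_3 -> 'rV[F]_2) i j k :
  rank1 v (idx3 i j k) = v 0 0 i * v 1 0 j * v 2 0 k.
Proof. by rewrite ffunE prod_ord3 !ffunE. Qed.

Lemma symmetric_SON_canonical Y :
  SON cj 3 Y -> symmetric_tensor Y -> canonical (entry Y).
Proof.
move=> [sg [v [so ->]]] /symmetric_entry sy.
have [a [co1 [s [a0 s0 va]]]] := mode_basis (fun k l h => (so k l h).2 0).
have [b [co2 [t [b0 t0 vb]]]] := mode_basis (fun k l h => (so k l h).2 1).
have [c [co3 [u [c0 u0 vc]]]] := mode_basis (fun k l h => (so k l h).2 2).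
pose co k := sg k * co1 k * co2 k * co3 k.
apply: (@canonical_three_terms _ a b c (co 0) (co 1) (co 2)
  (s 1) (t 1) (u 1) (s 2) (t 2) (u 2)) => // i j k.
rewrite /entry ffunE big_ord3 !rank1_idx3 !va !vb !vc s0 t0 u0 !scE /co /=.
by ring.
Qed.

(** * Parseval and the lower bound for symmetric approximations *)

Lemma example_distE Y :
  tensor_inner cj (example_tensor F - Y) (example_tensor F - Y) =
  `|entry Y 0 0 0| ^+ 2 + `|1 - entry Y 0 0 1| ^+ 2
  + `|1 - entry Y 0 1 0| ^+ 2 + `|entry Y 0 1 1| ^+ 2
  + `|1 - entry Y 1 0 0| ^+ 2 + `|entry Y 1 0 1| ^+ 2
  + `|entry Y 1 1 0| ^+ 2 + `|2 - entry Y 1 1 1| ^+ 2.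
Proof.
rewrite /tensor_inner sum_idx3 !big_ord2.
have sE i j k : (example_tensor F - Y) (idx3 i j k)
   = example_tensor F (idx3 i j k) - entry Y i j k by rewrite !ffunE.
rewrite !sE !mul_cj !(ffunE (fun _ : {ffun 'I_3 -> 'I_2} => _)) !ffunE /=.
by rewrite !sub0r !normrN !addrA.
Qed.

(* [tau m] is the inner product of the example tensor with a simple tensor
   having [3 - m] factors [a] and [m] factors [perp a]. *)
Definition tau0 a := 3 * cj (a 0 0) ^+ 2 * cj (a 0 1) + 2 * cj (a 0 1) ^+ 3.
Definition tau1 a := cj (a 0 0) * (`|a 0 0| ^+ 2 - 2 * `|a 0 1| ^+ 2)
  + 2 * cj (a 0 1) ^+ 2 * a 0 0.
Definition tau2 a := a 0 1 * (`|a 0 1| ^+ 2 - 2 * `|a 0 0| ^+ 2)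
  + 2 * cj (a 0 1) * a 0 0 ^+ 2.
Definition tau3 a := 3 * a 0 1 ^+ 2 * a 0 0 + 2 * a 0 0 ^+ 3.

(** Products of [a] and [perp a] form an orthogonal basis with squared norms [sqn a ^+ 3]; the
    weights 1, 3, 3, 1 count the products with a given number of factors [perp a], and 7 is the
    squared norm of the example tensor. *)
Lemma tau_parseval a :
  `|tau0 a| ^+ 2 + 3 * `|tau1 a| ^+ 2 + 3 * `|tau2 a| ^+ 2 + `|tau3 a| ^+ 2
  = 7 * sqn a ^+ 3.
Proof.
rewrite sqnE -!mul_cj /tau0 /tau1 /tau2 /tau3 -!mul_cj.
rewrite !(rmorphB, rmorphD, rmorphM, rmorphN, rmorphXn, rmorph_nat, rmorph1,
  cjK).
by rewrite /=; ring.
Qed.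

(** The same Parseval identity for the difference: [Y] has inner product [l * sqn a ^+ 3] with a
    basis product of coefficient [l]. *)
Lemma residual_parseval Y a l0 l1 l3 :
  (forall i j k, entry Y i j k =
    l0 * (a 0 i * a 0 j * a 0 k)
    + l1 * (perp a 0 i * a 0 j * a 0 k + a 0 i * perp a 0 j * a 0 k
            + a 0 i * a 0 j * perp a 0 k)
    + l3 * (perp a 0 i * perp a 0 j * perp a 0 k)) ->
  tensor_inner cj (example_tensor F - Y) (example_tensor F - Y) * sqn a ^+ 3 =
  `|tau0 a - l0 * sqn a ^+ 3| ^+ 2 + 3 * `|tau1 a - l1 * sqn a ^+ 3| ^+ 2
  + 3 * `|tau2 a| ^+ 2 + `|tau3 a - l3 * sqn a ^+ 3| ^+ 2.
Proof.
move=> h; rewrite example_distE !h !perp0 !perp1.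
rewrite sqnE -!mul_cj /tau0 /tau1 /tau2 /tau3 -!mul_cj.
rewrite !(rmorphB, rmorphD, rmorphM, rmorphN, rmorphXn, rmorph_nat, rmorph1,
  cjK).
rewrite /=.
(* The identity is polynomial even with numbers and their conjugates as independent variables. *)
move: (a 0 0) (a 0 1) (cj (a 0 0)) (cj (a 0 1)) (cj l0) (cj l1) (cj l3).
move=> p q P Q L0 L1 L3.
by ring.
Qed.

Lemma norm_cj (u : F) : `|cj u| = `|u|.
Proof.
by apply/eqP; rewrite -(@eqrXn2 _ 2) // -!mul_cj cjK mulrC.
Qed.

(** Taking the entries of [a], up to conjugation, in either order covers [tau0] and [tau3]. *)
Lemma sqr_norm_cubic (u v : F) :
  `|3 * u ^+ 2 * v + 2 * v ^+ 3| ^+ 2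
    <= `|v| ^+ 2 * (3 * `|u| ^+ 2 + 2 * `|v| ^+ 2) ^+ 2.
Proof.
rewrite -exprMn lerXn2r ?nnegrE ?mulr_ge0 ?addr_ge0 ?exprn_ge0 //.
  by rewrite mulr_ge0 ?exprn_ge0.
  by rewrite mulr_ge0 ?exprn_ge0.
apply: le_trans (ler_normD _ _) _.
rewrite !normrM !normr_nat.
by rewrite le_eqVlt; apply/orP; left; apply/eqP; ring.
Qed.

Lemma tau_cubes_le a :
  `|tau0 a| ^+ 2 + `|tau3 a| ^+ 2 <= 25 / 4 * sqn a ^+ 3.
Proof.
apply: le_trans (lerD (sqr_norm_cubic _ _) (sqr_norm_cubic _ _)) _.
rewrite !norm_cj /sqn.
set A := `|a 0 0| ^+ 2; set B := `|a 0 1| ^+ 2.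
have A0 : 0 <= A by rewrite exprn_ge0.
have B0 : 0 <= B by rewrite exprn_ge0.
(* The gap vanishes at [A = B]; the constant 25/4 is attained at [a = (1,1)]. *)
rewrite -subr_ge0 (_ : _ - _ = 9 / 4 * ((A + B) * (A - B) ^+ 2)).
  rewrite mulr_ge0 ?divr_ge0 // mulr_ge0 ?addr_ge0 //.
  by rewrite real_exprn_even_ge0 // rpredB // ger0_real.
by field.
Qed.

Lemma tau_mixed_le a : 3 * `|tau1 a| ^+ 2 <= 25 / 4 * sqn a ^+ 3.
Proof.
rewrite /sqn.
set A := `|a 0 0| ^+ 2; set B := `|a 0 1| ^+ 2.
have A0 : 0 <= A by rewrite exprn_ge0.
have B0 : 0 <= B by rewrite exprn_ge0.
have le1 : `|tau1 a| ^+ 2 <= A * (`|A - 2 * B| + 2 * B) ^+ 2.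
  rewrite -exprMn lerXn2r ?nnegrE ?mulr_ge0 ?addr_ge0 ?mulr_ge0 //.
  apply: le_trans (ler_normD _ _) _.
  rewrite !normrM !normr_nat !norm_cj -/A -/B.
  by rewrite le_eqVlt; apply/orP; left; apply/eqP; rewrite /B; ring.
apply: le_trans (ler_wpM2l _ le1) _ => //.
have rA : A \is Num.real by rewrite ger0_real.
have rB : B \is Num.real by rewrite ger0_real.
have r2B : 2 * B \is Num.real by rewrite rpredM ?realn.
(* The left side becomes [3 A^3] if [2 B <= A], and [3 A (4 B - A)^2] otherwise. *)
have [le|lt] := real_leP r2B rA.
  rewrite -subr_ge0.
  rewrite (_ : _ - _ = 13 / 4 * A ^+ 3
     + 25 / 4 * (3 * (A ^+ 2 * B) + 3 * (A * B ^+ 2) + B ^+ 3)); last by field.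
  by rewrite ?(ler0n, exprn_ge0, divr_ge0, mulr_ge0, addr_ge0).
rewrite -subr_ge0.
(* The square is completed in [25 B^2 - 117 A B + 171 A^2]. *)
rewrite (_ : _ - _ = 13 / 4 * A ^+ 3
  + B / 4 * ((5 * B - 117 / 10 * A) ^+ 2 + 3411 / 100 * A ^+ 2)); last by field.
have sq0 : 0 <= (5 * B - 117 / 10 * A) ^+ 2.
  by rewrite real_exprn_even_ge0 // rpredB // rpredM // ?rpred_div ?realn.
by rewrite ?(sq0, ler0n, exprn_ge0, divr_ge0, mulr_ge0, addr_ge0).
Qed.

(** Subtracting [Y] alters only the components in its support; after division by [sqn a ^+ 3], the
    others keep squared norm at least 7 - 25/4 = 3/4. *)
Lemma symmetric_SON_dist_ge Y : SON cj 3 Y -> symmetric_tensor Y ->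
  3 / 4 <= tensor_inner cj (example_tensor F - Y) (example_tensor F - Y).
Proof.
move=> sonY symY.
have [a [l0 [l1 [l3 [a0 h l]]]]] := symmetric_SON_canonical sonY symY.
have N0 : 0 < sqn a ^+ 3 by rewrite exprn_gt0 ?sqn_gt0.
rewrite -(ler_pM2r N0) (residual_parseval h).
have sq0 (u : F) : 0 <= `|u| ^+ 2 by rewrite exprn_ge0.
have split7 : 3 / 4 * sqn a ^+ 3 = 7 * sqn a ^+ 3 - 25 / 4 * sqn a ^+ 3.
  by field.
case: l => [l10|[l00 l30]].
  apply: (@le_trans _ _ (3 * `|tau1 a| ^+ 2 + 3 * `|tau2 a| ^+ 2)).
    rewrite split7 lerBlDr -tau_parseval.
    rewrite (_ : _ + _ = 3 * `|tau1 a| ^+ 2 + 3 * `|tau2 a| ^+ 2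
      + (`|tau0 a| ^+ 2 + `|tau3 a| ^+ 2)); last by ring.
    by rewrite lerD2l tau_cubes_le.
  rewrite l10 mul0r subr0 -addrA -addrA ler_wpDl // addrA.
  by rewrite ler_wpDr.
apply: (@le_trans _ _ (`|tau0 a| ^+ 2 + 3 * `|tau2 a| ^+ 2 + `|tau3 a| ^+ 2)).
  rewrite split7 lerBlDr -tau_parseval.
  rewrite (_ : _ + _ = `|tau0 a| ^+ 2 + 3 * `|tau2 a| ^+ 2 + `|tau3 a| ^+ 2
    + 3 * `|tau1 a| ^+ 2); last by ring.
  by rewrite lerD2l tau_mixed_le.
rewrite l00 l30 !mul0r !subr0 lerD2r lerD2r.
by rewrite ler_wpDr // mulr_ge0.
Qed.

(** * A better nonsymmetric approximation *)

Definition sgn_row (s : bool) : 'rV[F]_2 := \row_i (-1) ^+ (s && (i == 1)).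

(** With u = (1,1) and v = (1,-1), the terms are uuu, vvv and uuv. *)
Definition better_terms (k j : 'I_3) : 'rV[F]_2 :=
  sgn_row ((k == 1) || (k == 2) && (j == 2)).

(** The inner products 5, -5, -1 of the example tensor with the terms, divided by their squared norm
    8. *)
Definition better_coef (k : 'I_3) : F :=
  if k == 0 then 5 / 8 else if k == 1 then - (5 / 8) else - (1 / 8).

Definition better_tensor : tensor F 2 3 :=
  [ffun i => \sum_(k < 3) better_coef k * rank1 (better_terms k) i].

Lemma tensor_inner_rank1 (x z : 'I_3 -> 'rV[F]_2) :
  tensor_inner cj (rank1 x) (rank1 z) = \prod_j vec_inner cj (x j) (z j).
Proof.
rewrite /vec_inner bigA_distr_bigA; apply: eq_bigr => i _.
by rewrite !ffunE rmorph_prod -big_split.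
Qed.

Lemma sgn_row_orth s t : s != t -> vec_inner cj (sgn_row s) (sgn_row t) = 0.
Proof.
move=> st; rewrite /vec_inner big_ord2 !mxE !andbF !andbT !rmorphXn rmorphN.
rewrite !rmorph1 mulr1.
by case: s t st => -[] //= _; rewrite ?mul1r ?mulr1 subrr.
Qed.

Lemma better_SON : SON cj 3 better_tensor.
Proof.
exists better_coef, better_terms; split => // k l kl; split; last first.
  move=> j; have [->|st] := eqVneq (better_terms k j) (better_terms l j).
    by right; exists 1; rewrite oner_eq0 scale1r.
  left; apply: sgn_row_orth; apply: contra st => /eqP e.
  by rewrite /better_terms e.
rewrite tensor_inner_rank1 prod_ord3.
case: (ord3P k) (ord3P l) kl => -> [] -> // _.
(* Terms 0 and 2 are orthogonal in the last mode, every other pair in the first. *)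
all: try by rewrite [X in X * _ * _]sgn_row_orth ?mul0r.
all: by rewrite [X in _ * _ * X]sgn_row_orth ?mulr0.
Qed.

(** By Pythagoras the value is 7 - (25 + 25 + 1)/8. *)
Lemma better_dist :
  tensor_inner cj (example_tensor F - better_tensor)
    (example_tensor F - better_tensor) = 5 / 8.
Proof.
rewrite example_distE /entry !ffunE !big_ord3 !rank1_idx3 !mxE /better_coef /=.
rewrite -!mul_cj.
rewrite !(rmorphB, rmorphD, rmorphM, rmorphN, rmorphXn, fmorphV, rmorph_nat,
  rmorph1).
by rewrite /=; field.
Qed.

(** * Comparison of the two distances *)

Lemma optimal_not_symmetric (R : realType) (re : F -> R) Y :
  re 0 = 0 -> {homo re : x y / x < y} ->
  optimal_SON_approx cj re 3 (example_tensor F) Y -> ~ symmetric_tensor Y.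
Proof.
move=> re0 re_lt [sonY /(_ _ better_SON)] + symY.
have lt : 5 / 8 < tensor_inner cj (example_tensor F - Y) (example_tensor F - Y).
  apply: lt_le_trans (symmetric_SON_dist_ge sonY symY).
  rewrite -subr_gt0 (_ : _ - _ = 1 / 8); last by field.
  by rewrite divr_gt0.
(* The strict inequality in [F] passes to [R] through [re], then to the square roots. *)
rewrite /tensor_norm better_dist leNgt ltr_sqrt ?re_lt //.
by rewrite -re0 re_lt // (lt_trans _ lt) // divr_gt0.
Qed.

End Scalars.

Theorem theorem4p12 (R : realType) :
  (forall Y : tensor R 2 3,
     optimal_SON_approx (fun x : R => x) (fun x : R => x) 3
       (example_tensor R) Y ->
     ~ symmetric_tensor Y) /\
  (forall Y : tensor (complex R) 2 3,
     optimal_SON_approx (@conjc R) (@complex.Re R) 3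
       (example_tensor (complex R)) Y ->
     ~ symmetric_tensor Y).
Proof.
split=> Y.
  apply: (@optimal_not_symmetric R idfun) => // x.
  by rewrite real_normK ?num_real.
apply: (@optimal_not_symmetric (complex R) (@conjc R)) => //.
- exact: conjcK.
- by move=> x; rewrite sqr_normc.
(* Comparable complex numbers share their imaginary part, so [<] compares the real parts. *)
- by move=> x y; rewrite ltcE => /andP[].
Qed.
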